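(* Let $\alpha$ be an order type (of a chain). There is a set $\mathbb{B}_{\alpha}$ of join-semilattices, of cardinality at most $2^{|\alpha|}$, such that for every join-semilattice $P$, the set $J(P)$ of ideals of $P$ contains a chain of type $I(\alpha)$ if and only if $P$ contains a join-subsemilattice isomorphic to a member of $\mathbb{B}_{\alpha}$.
   Context: A join-semilattice is a poset in which any two elements have a least upper bound; a join-subsemilattice is a subset closed under binary joins, with the induced order. An ideal of a poset $P$ is a non-empty up-directed initial segment (down-closed subset) of $P$; $J(P)$ is the set of ideals of $P$ ordered by inclusion. For an order type $\alpha$, $I(\alpha)$ is the order type of the chain of all initial segments (including the empty one and the whole chain), ordered by inclusion, of a chain of type $\alpha$; $|\alpha|$ is the cardinality of a chain of type $\alpha$. A poset contains a chain of type $\beta$ if some subset of it, with the induced order, is a chain of type $\beta$. *)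

(* Defs.v *)
From mathcomp Require Import all_boot all_order.
From mathcomp Require Import boolp classical_sets.

Set Implicit Arguments.
Unset Strict Implicit.
Unset Printing Implicit Defensive.

Local Open Scope classical_set_scope.
Local Open Scope order_scope.

(* [A] and [B] carry the induced orders. For sets of sets, the order of the
   ambient type [set T] is inclusion (see [subsetEset]). *)
Definition order_isomorphic (d d' : Order.disp_t) (T : porderType d)
    (U : porderType d') (A : set T) (B : set U) : Prop :=
  exists f : A -> B, bijective f /\
    forall x y : A, (val (f x) <= val (f y)) = (val x <= val y).

Definition initial_segment (d : Order.disp_t) (T : porderType d) (I : set T) :
  Prop := forall x y : T, x <= y -> I y -> I x.

Definition up_directed (d : Order.disp_t) (T : porderType d) (I : set T) :
  Prop := forall x y : T, I x -> I y -> exists z : T, [/\ I z, x <= z & y <= z].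

Definition initial_segments (d : Order.disp_t) (T : porderType d) :
  set (set T) := [set I | initial_segment I].
Arguments initial_segments {d} T.

Definition ideals (d : Order.disp_t) (T : porderType d) : set (set T) :=
  [set I | [/\ I !=set0, initial_segment I & up_directed I]].
Arguments ideals {d} T.

(* [D] contains a subset which, with the induced order, is isomorphic to [C]. *)
Definition contains_copy (d d' : Order.disp_t) (U : porderType d')
    (D : set U) (T : porderType d) (C : set T) : Prop :=
  exists2 E : set U, E `<=` D & order_isomorphic C E.

Definition join_subsemilattice (d : Order.disp_t) (P : joinSemilatticeType d)
    (S : set P) : Prop := forall x y : P, S x -> S y -> S (x `|` y).

(* The cardinality of the class [B] is at most that of the power set of [T].
   For universe reasons [B] cannot be a [set] when [K] is a type of
   structures, so [card_le] does not apply. *)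
Definition card_le_powerset (K : Type) (B : K -> Prop) (T : Type) : Prop :=
  exists f : K -> set T, forall x y : K, B x -> B y -> f x = f y -> x = y.

(* Main.v *)
(* Given the chain, choose [x_a] in the ideal of the segment [<= a] but not in the
   ideal of the segment [< a], and [x0] in the ideal of the empty segment. The
   joins [e l] of [x0] with the [x_a], [a] in a finite word [l], form a
   join-subsemilattice of [P] isomorphic to a quotient of the words by a preorder
   for which concatenation is the join and [a] is never below a word of elements
   [< a]. Conversely, such a separated quotient always yields the chain: the
   segment [I] goes to the ideal generated by the words in [I]. The members of
   the family are these quotients; for infinite [A] they are counted through an
   injection of [seq A * seq A] into [A]. *)
Require Import Defs.
From HB Require Import structures.
From mathcomp Require Import all_boot all_order.
From mathcomp Require Import boolp classical_sets functions cardinality.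

Set Implicit Arguments.
Unset Strict Implicit.
Unset Printing Implicit Defensive.

Import Order.TTheory.
Local Open Scope classical_set_scope.
Local Open Scope order_scope.

(** * Comparability of sets, and codings in an infinite type *)

Definition injects (T U : Type) (X : set T) (Y : set U) (f : T -> U) : Prop :=
  (forall x, X x -> Y (f x)) /\
  forall x y, X x -> X y -> f x = f y -> x = y.

(** Comparability of cardinals by Zorn's lemma: a maximal partial matching between [X] and [Y]
    exhausts one of them. *)
Lemma injects_total (T : Type) (X Y : set T) :
  (exists f, injects X Y f) \/ (exists f, injects Y X f).
Proof.
pose matching (G : set (T * T)) :=
  (forall p, G p -> X p.1 /\ Y p.2) /\
  forall p q, G p -> G q -> p.1 = q.1 \/ p.2 = q.2 -> p = q.
have [F Fm Ftot|G [[GXY Ginj] Gmax]] := @Zorn_bigcup _ matching.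
  split=> [p [G /Fm[GXY _]]|p q [G FG Gp] [H FH Hq]]; first exact: GXY.
  have [GH|HG] := Ftot _ _ FG FH.
    by apply: (Fm _ FH).2 => //; exact: GH.
  by apply: (Fm _ FG).2 => //; exact: HG.
have [[x [Xx Gx]]|XG] := pselect (exists x, X x /\ forall y, ~ G (x, y)); last first.
  left; have /choice[f fP] x : exists y, X x -> G (x, y).
    have [Xx|] := pselect (X x); last by exists x.
    apply: contrapT => Gx; apply: XG; exists x; split=> // y Gxy.
    by apply: Gx; exists y.
  exists f; split=> [x /fP/GXY[]//|x y /fP Gx /fP Gy fxy].
  by have [] := Ginj _ _ Gx Gy (or_intror fxy).
right; have /choice[f fP] y : exists z, Y y -> G (z, y).
  (* Here [x] is unmatched; were [y] unmatched too, adding [(x, y)] would contradict maximality. *)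
  have [Yy|] := pselect (Y y); last by exists y.
  apply: contrapT => Gy; apply: (Gmax (G `|` [set (x, y)])).
    split=> [p|sub]; first by left.
    by apply: (Gx y); apply: sub; right.
  have {}Gy z : ~ G (z, y) by move=> Gzy; apply: Gy; exists z.
  split=> [p [/GXY//|->//]|p q [Gp|->] [Gq|->]] //=; first exact: Ginj.
    by case: p Gp => p1 p2 /= Gp [] e; move: Gp; rewrite e => ?;
      [case: (Gx p2)|case: (Gy p1)].
  by case: q Gq => p1 p2 /= Gp [] e; move: Gp; rewrite -e => ?;
    [case: (Gx p2)|case: (Gy p1)].
exists f; split=> [y /fP/GXY[]//|y z /fP Gy /fP Gz fyz].
by have [] := Ginj _ _ Gy Gz (or_introl fyz).
Qed.

Lemma infinite_nat_injection (A : Type) :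
  infinite_set [set: A] -> exists i : nat -> A, injective i.
Proof.
move=> /infiniteP/card_leP/injfunPex[i _ i_inj].
exists (fun n => \val (i (SigSub (mem_set (I : [set: nat] n))))) => m n /val_inj.
by move=> /(i_inj _ _ (in_setT _) (in_setT _)) /(congr1 val).
Qed.

(* Zorn's lemma is applied to the pairing relations on subsets [X] of [A], the
   field [X] being read off the diagonal. If a maximal one had a field [X] whose
   complement contains a copy [h X] of [X], it would extend to [X `|` h X]: the
   new pairs are coded in [h X], since [X] has at least four elements and hence
   codes [bool * bool * X * X]. So the complement of [X] injects into [X]. *)
Lemma infinite_pairing (A : Type) :
  infinite_set [set: A] -> exists p : A -> A -> A,
    forall x y x' y', p x y = p x' y' -> x = x' /\ y = y'.
Proof.
move=> /infinite_nat_injection[i i_inj].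
pose field (G : set (A * A * A)) x := exists z, G (x, x, z).
pose pairing G := [/\ forall x y z, G (x, y, z) ->
      [/\ field G x, field G y & field G z],
    forall x y, field G x -> field G y -> exists z, G (x, y, z) &
    forall x y x' y' z, G (x, y, z) -> G (x', y', z) -> x = x' /\ y = y'].
have fieldS (G H : set (A * A * A)) : G `<=` H -> field G `<=` field H.
  by move=> GH x [z /GH]; exists z.
pose G0 : set (A * A * A) :=
  [set t | exists m n, t = (i m, i n, i (pickle (m, n)))].
have field0 x : field G0 x <-> exists n, x = i n.
  split=> [[z [m [n [-> _ _]]]]|[n ->]]; first by exists m.
  by exists (i (pickle (n, n))), n, n.
have pair0 : pairing G0.
  split=> [x y z [m [n [-> -> ->]]]|x y /field0[m ->] /field0[n ->]|].
  - by split; apply/field0; [exists m|exists n|exists (pickle (m, n))].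
  - by exists (i (pickle (m, n))), m, n.
  - move=> x y x' y' z [m [n [-> -> ->]]] [m' [n' [-> -> /i_inj]]].
    by move=> /(pcan_inj pickleK)[-> ->].
have [F FP Ftot|G [[[Gfld Gtot Ginj] GG0] Gmax]] :=
    @Zorn_bigcup _ [set G | pairing G /\ (G !=set0 -> G0 `<=` G)].
  have FU G : F G -> G `<=` \bigcup_(X in F) X by move=> FG; apply: bigcup_sup.
  have Fmax G H : F G -> F H -> exists2 K, F K & G `<=` K /\ H `<=` K.
    move=> FG FH; have [GH|HG] := Ftot _ _ FG FH; [exists H|exists G] => //;
    by split=> // t.
  split=> [|[t [G FG Gt]]]; last first.
    by apply: subset_trans (FU _ FG); apply: (FP _ FG).2; exists t.
  split=> [x y z [G FG Gxyz]|x y [u [G FG Gu]] [v [H FH Hv]]|].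
  - have [[Gfld _ _] _] := FP _ FG.
    by have [] := Gfld _ _ _ Gxyz; split; apply: fieldS (FU _ FG) _ _.
  - have [K FK [GK HK]] := Fmax _ _ FG FH; have [[_ Ktot _] _] := FP _ FK.
    have [||z Kz] := Ktot x y; [by exists u; apply: GK|by exists v; apply: HK|].
    by exists z, K.
  - move=> x y x' y' z [G FG Gz] [H FH Hz].
    have [K FK [GK HK]] := Fmax _ _ FG FH; have [[_ _ Kinj] _] := FP _ FK.
    by apply: Kinj (GK _ Gz) (HK _ Hz).
have {}GG0 : G0 `<=` G.
  have [/eqP G_eq0|/set0P/GG0//] := boolP (G == set0).
  have [] := Gmax G0; last by split=> // _ t.
  rewrite G_eq0; split=> // /(_ (i 0, i 0, i (pickle (0, 0)))); apply.
  by exists 0, 0.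
pose X := field G.
have Xi n : X (i n) by apply: fieldS GG0 _ _; apply/field0; exists n.
have /choice[p0 p0P] (t : A * A) : exists z, X t.1 -> X t.2 -> G (t.1, t.2, z).
  have [[X1 X2]|nX] := pselect (X t.1 /\ X t.2); last first.
    by exists t.1 => X1 X2; case: nX.
  by have [z Gz] := Gtot _ _ X1 X2; exists z.
pose p x y := p0 (x, y).
have pP x y : X x -> X y -> G (x, y, p x y) by move=> Xx Xy; apply: (p0P (x, y)).
have Xp x y : X x -> X y -> X (p x y).
  by move=> Xx Xy; have [] := Gfld _ _ _ (pP _ _ Xx Xy).
have p_inj x y x' y' : X x -> X y -> X x' -> X y' ->
    p x y = p x' y' -> x = x' /\ y = y'.
  move=> Xx Xy Xx' Xy' e; apply: (Ginj _ _ _ _ (p x y)); first exact: pP.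
  by rewrite e; apply: pP.
have [[h [hX h_inj]]|[k [kX k_inj]]] := injects_total X (~` X); last first.
  (* All of [A] is injected into [X]; the tags [i 0] and [i 1] separate [X] from its complement. *)
  pose j x := if pselect (X x) then p (i 0) x else p (i 1) (k x).
  have Xj x : X (j x).
    by rewrite /j; case: pselect => Xx; apply: Xp => //; apply: kX.
  have j_inj x y : j x = j y -> x = y.
    rewrite /j; case: pselect => Xx; case: pselect => Xy e.
    - by have [] := p_inj _ _ _ _ (Xi 0) Xx (Xi 0) Xy e.
    - by have [/i_inj] := p_inj _ _ _ _ (Xi 0) Xx (Xi 1) (kX _ Xy) e.
    - by have [/i_inj] := p_inj _ _ _ _ (Xi 1) (kX _ Xx) (Xi 0) Xy e.
    - by have [_ /k_inj] := p_inj _ _ _ _ (Xi 1) (kX _ Xx) (Xi 1) (kX _ Xy) e; apply.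
  exists (fun x y => p (j x) (j y)) => x y x' y' e.
  by have [/j_inj-> /j_inj->] := p_inj _ _ _ _ (Xj x) (Xj y) (Xj x') (Xj y') e.
pose lift (b : bool) x := if b then x else h x.
pose code (b c : bool) x y := h (p (i (pickle (b, c))) (p x y)).
have Xcode (b c : bool) x y : X x -> X y -> X (p (i (pickle (b, c))) (p x y)).
  by move=> Xx Xy; apply: (Xp) => //; apply: Xp.
(* Pairs with both coordinates in [X] are already coded by [G]; [N] adds those with at least one
   coordinate in the image of [X] under [h]. *)
pose N : set (A * A * A) := [set t | exists b c x y,
  [/\ X x, X y, ~~ (b && c) & t = (lift b x, lift c y, code b c x y)]].
have fieldN x : field (G `|` N) x <-> exists b y, X y /\ x = lift b y.
  split=> [[z [Gz|[b [c [y [y' [Xy _ _ [-> _ _]]]]]]]]|[[] [y [Xy ->]]]].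
  - by exists true, x; split=> //; exists z.
  - by exists b, y.
  - by case: Xy => z Gz; exists z; left.
  - by exists (code false false y y); right; exists false, false, y, y.
case: (Gmax (G `|` N)).
  split=> [t|sub]; first by left.
  suff : X (h (i 0)) by exact: (hX _ (Xi 0)).
  exists (code false false (i 0) (i 0)); apply: sub; right.
  by exists false, false, (i 0), (i 0).
split=> [|_ t /GG0]; last by left.
split=> [x y z [Gz|[b [c [x' [y' [Xx Xy _ [-> -> ->]]]]]]]||].
- have [Xx Xy Xz] := Gfld _ _ _ Gz.
  by split; apply/fieldN; [exists true, x|exists true, y|exists true, z].
- split; apply/fieldN; [by exists b, x'|by exists c, y'|].
  by exists false, (p (i (pickle (b, c))) (p x' y')); split=> //; apply: Xcode.
- move=> _ _ /fieldN[b [x [Xx ->]]] /fieldN[c [y [Xy ->]]].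
  have [/andP[-> ->]|bc] := boolP (b && c).
    by have [z Gz] := Gtot _ _ Xx Xy; exists z; left.
  by exists (code b c x y); right; exists b, c, x, y.
(* Old codes lie in [X] and new ones outside, so only codes of the same kind can coincide. *)
- have GN x y z : G (x, y, z) -> forall b c x' y', X x' -> X y' ->
      z <> code b c x' y'.
    move=> /Gfld[_ _ Xz] b c x' y' Xx' Xy' ez.
    by case: (hX _ (Xcode b c _ _ Xx' Xy')); rewrite -[h _]ez.
  move=> x y x' y' z [Gz|[b [c [u [v [Xu Xv _ [-> -> ez]]]]]]].
    move=> [|[b [c [u [v [Xu Xv _ [_ _ ez]]]]]]]; first exact: Ginj.
    by case: (GN _ _ _ Gz _ _ _ _ Xu Xv ez).
  move=> [Gz|[b' [c' [u' [v' [Xu' Xv' _ [-> -> ez']]]]]]].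
    by case: (GN _ _ _ Gz _ _ _ _ Xu Xv ez).
  move: ez; rewrite ez' => /h_inj e.
  have /p_inj[] // := e (Xcode _ _ _ _ Xu' Xv') (Xcode _ _ _ _ Xu Xv).
  + exact: Xp.
  + exact: Xp.
  + by move=> /i_inj/(pcan_inj pickleK)[-> ->] /p_inj[]// -> ->.
Qed.

(** The length is coded along with the iterated pairing, whose injectivity is guaranteed only among
    words of equal length. *)
Lemma infinite_seq_coding (A : Type) :
  infinite_set [set: A] -> exists f : seq A * seq A -> A, injective f.
Proof.
move=> Ainf; have [p p_inj] := infinite_pairing Ainf.
have [i i_inj] := infinite_nat_injection Ainf.
pose c l := p (i (size l)) (foldr p (i 0) l).
have c_inj l m : c l = c m -> l = m.
  move=> /p_inj[/i_inj]; elim: l m => [|a l IH] [|b m] //= [e].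
  by move=> /p_inj[-> /(IH _ e)->].
exists (fun t => p (c t.1) (c t.2)) => -[l m] [l' m'].
by move=> /p_inj[/c_inj /= -> /c_inj /= ->].
Qed.

(** * Order isomorphisms between subsets *)

Lemma order_isomorphic_sym (d d' : Order.disp_t) (T : porderType d)
    (U : porderType d') (X : set T) (Y : set U) :
  order_isomorphic X Y -> order_isomorphic Y X.
Proof.
move=> [f [[g fK gK] f_le]]; exists g; split; first by exists f.
by move=> x y; rewrite -f_le !gK.
Qed.

Lemma order_isomorphic_image (d d' : Order.disp_t) (T : porderType d)
    (U : porderType d') (X : set T) (h : T -> U) :
  (forall x y, X x -> X y -> (h x <= h y) = (x <= y)) ->
  order_isomorphic X (h @` X).
Proof.
move=> h_le; pose f (x : X) : h @` X :=
  SigSub (mem_set (imageP h (set_mem (valP x)))).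
have /choice[g gK] (y : h @` X) : exists x, f x = y.
  case: (set_mem (valP y)) => x Xx hx.
  by exists (SigSub (mem_set Xx)); apply: val_inj.
have f_le (x y : X) : (val (f x) <= val (f y)) = (val x <= val y).
  by apply: h_le; apply: set_mem; apply: valP.
exists f; split=> //; exists g => // x; apply/val_inj/le_anti.
by rewrite -!f_le !gK lexx.
Qed.

(** * Join-preorders on words and their quotient semilattices *)

(** [jp_cat] makes concatenation a least upper bound. With reflexivity it also puts the empty word
    below every word. *)
Record join_preorder (A : Type) := JoinPreorder {
  jp_rel :> seq A -> seq A -> Prop;
  jp_refl : forall l, jp_rel l l;
  jp_trans : forall l m n, jp_rel l m -> jp_rel m n -> jp_rel l n;
  jp_cat : forall l m n, jp_rel (l ++ m) n <-> jp_rel l n /\ jp_rel m n }.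

Lemma join_preorder_inj (A : Type) (R S : join_preorder A) :
  (forall l m, R l m <-> S l m) -> R = S.
Proof.
case: R S => [R R1 R2 R3] [S S1 S2 S3] /= RS.
have {}RS : R = S by apply/funext => l; apply/funext => m; apply/propext.
by case: _ / RS in S1 S2 S3 *; congr JoinPreorder; exact: Prop_irrelevance.
Qed.

(* The quotient of [seq A] by the equivalence associated with [R], the class of
   a word being represented by its principal down-set. *)
Definition jp_quotient (d : Order.disp_t) (A : Type) (R : join_preorder A) :=
  {C : set (seq A) | `[< exists l, C = R^~ l >]}.

Section QuotientSemilattice.
Variables (d : Order.disp_t) (A : Type) (R : join_preorder A).
Local Notation Q := (jp_quotient d R).

HB.instance Definition _ := Choice.copy Q
  {C : set (seq A) | `[< exists l, C = R^~ l >]}.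

Definition jp_class (l : seq A) : Q :=
  exist _ (R^~ l) (asboolT (ex_intro _ l erefl)).

Lemma jp_class_surj (q : Q) : exists l, jp_class l = q.
Proof.
by case: q => C pC; have /asboolP[l eC] := pC; exists l; apply: val_inj.
Qed.

Definition jp_repr (q : Q) : seq A := sval (cid (jp_class_surj q)).

Lemma jp_reprK : cancel jp_repr jp_class.
Proof. by move=> q; rewrite /jp_repr; case: cid. Qed.

Definition jp_le (q r : Q) : bool := `[< R (jp_repr q) (jp_repr r) >].

Lemma jp_class_eq l m : jp_class l = jp_class m <-> R l m /\ R m l.
Proof.
split=> [/(congr1 sval) lm|[lm ml]].
  have {}lm n : R n l = R n m by apply: (congr1 (@^~ n) lm).
  by split; [rewrite -lm|rewrite lm]; apply: jp_refl.
apply: val_inj; apply/funext => n /=; apply/propext.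
by split=> [nl|nm]; [apply: jp_trans nl lm|apply: jp_trans nm ml].
Qed.

Lemma jp_repr_class l : R l (jp_repr (jp_class l)) /\ R (jp_repr (jp_class l)) l.
Proof. by apply/jp_class_eq; rewrite jp_reprK. Qed.

Let jp_le_refl : reflexive jp_le.
Proof. by move=> q; apply/asboolP; apply: jp_refl. Qed.

Let jp_le_anti : antisymmetric jp_le.
Proof.
move=> q r /andP[/asboolP qr /asboolP rq].
by rewrite -[q]jp_reprK -[r]jp_reprK; apply/jp_class_eq.
Qed.

Let jp_le_trans : transitive jp_le.
Proof.
by move=> r q s /asboolP qr /asboolP rs; apply/asboolP; apply: jp_trans qr rs.
Qed.

HB.instance Definition _ :=
  Order.Le_isPOrder.Build d Q jp_le_refl jp_le_anti jp_le_trans.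

Lemma jp_class_le l m : (jp_class l <= jp_class m) = `[< R l m >].
Proof.
have [l1 l2] := jp_repr_class l; have [m1 m2] := jp_repr_class m.
apply/asboolP/asboolP => h.
  exact: jp_trans l1 (jp_trans h m2).
exact: jp_trans l2 (jp_trans h m1).
Qed.

Definition jp_join (q r : Q) : Q := jp_class (jp_repr q ++ jp_repr r).

Let jp_joinP (q r s : Q) : (jp_join q r <= s) = (q <= s) && (r <= s).
Proof.
rewrite -[s]jp_reprK jp_class_le -{2}[q]jp_reprK -{2}[r]jp_reprK !jp_class_le.
by rewrite -asbool_and; apply: asbool_equiv_eq; apply: jp_cat.
Qed.

HB.instance Definition _ := Order.POrder_isJoinSemilattice.Build d Q jp_joinP.

End QuotientSemilattice.

Definition jp_represents (A : Type) (d : Order.disp_t)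
    (P : joinSemilatticeType d) (R : join_preorder A) (e : seq A -> P) :=
  (forall l m, e (l ++ m) = e l `|` e m) /\ forall l m, R l m <-> e l <= e m.

(** A representation [e] factors through an embedding of the quotient; conversely, an isomorphism
    composed with the class map is a representation. *)
Lemma contains_quotient (A : Type) (d d' : Order.disp_t)
    (P : joinSemilatticeType d') (R : join_preorder A) :
  (exists e : seq A -> P, jp_represents R e) <->
  exists2 S : set P, join_subsemilattice S &
    order_isomorphic S [set: jp_quotient d R].
Proof.
split=> [[e [e_cat e_le]]|[S Sjoin [f [[g fK gK] f_le]]]].
  pose h (q : jp_quotient d R) := e (jp_repr q).
  exists (h @` setT).
    move=> _ _ [q _ <-] [r _ <-]; exists (jp_join q r) => //.
    rewrite /h -e_cat; apply: le_anti.
    have [cr rc] := jp_repr_class d R (jp_repr q ++ jp_repr r).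
    by apply/andP; split; apply/e_le.
  apply/order_isomorphic_sym/order_isomorphic_image => q r _ _.
  rewrite -[q in RHS]jp_reprK -[r in RHS]jp_reprK jp_class_le.
  by apply/idP/asboolP => /e_le.
pose t (q : jp_quotient d R) : [set: jp_quotient d R] := SigSub (mem_set (I : setT q)).
pose e l := val (g (t (jp_class d R l))).
have e_le l m : R l m <-> e l <= e m.
  rewrite /e -f_le !gK /= jp_class_le; split; first by move/asboolP.
  by move/asboolP.
exists e; split=> // l m.
have Se n : S (e n) by apply: set_mem; apply: valP.
(* The join of [e l] and [e m] taken in [P] stays in [S], so it is [e n] for some word [n]; the rest
   shows that [n] and [l ++ m] are equivalent. *)
have [n en] : exists n, e n = e l `|` e m.
  pose s : S := SigSub (mem_set (Sjoin _ _ (Se l) (Se m))).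
  have [n fs] := jp_class_surj (val (f s)); exists n.
  by rewrite /e fs (_ : t _ = f s) ?fK //; apply: val_inj.
have [lc mc] := (jp_cat R l m (l ++ m)).1 (jp_refl R _).
have ln : R l n by apply/e_le; rewrite en leUl.
have mn : R m n by apply/e_le; rewrite en leUr.
apply/le_anti/andP; split; last by rewrite leUx; apply/andP; split; apply/e_le.
by rewrite -en; apply/e_le/jp_cat.
Qed.

(** * From separated preorders to chains of ideals *)

Definition jp_separated (d : Order.disp_t) (A : orderType d)
    (R : join_preorder A) : Prop :=
  forall a l, (forall b, b \in l -> b < a) -> ~ R [:: a] l.

(** If [h I] is contained in [h J] and [a] is in [I] but not in [J], then [[:: a]] is below a word
    in [J], whose letters are all [< a] because [J] is an initial segment; separation forbids this.
    The empty word keeps [h set0] non-empty. *)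
Lemma ideals_contain_initial_segments (dA dP : Order.disp_t) (A : orderType dA)
    (P : joinSemilatticeType dP) (R : join_preorder A) (e : seq A -> P) :
  jp_separated R -> jp_represents R e ->
  contains_copy (ideals P) (initial_segments A).
Proof.
move=> Rsep [e_cat e_le].
pose h (I : set A) : set P :=
  [set p | exists2 l, (forall a, a \in l -> I a) & p <= e l].
exists (h @` initial_segments A); last first.
  apply: order_isomorphic_image => I J _ Jinit.
  apply/subsetPset/subsetPset => [hIJ a Ia|IJ p [l lI pl]]; last first.
    by exists l => // a /lI/IJ.
  have [|l lJ /e_le Ral] := hIJ (e [:: a]).
    by exists [:: a] => // b; rewrite inE => /eqP->.
  apply: contrapT => Ja; apply: (Rsep a l) => // b /lJ Jb.
  by rewrite ltNge; apply/negP => /Jinit/(_ Jb).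
move=> _ [I Iinit <-]; split.
- by exists (e [::]), [::].
- by move=> p q pq [l lI ql]; exists l => //; apply: le_trans ql.
- move=> p q [l lI pl] [m mI qm]; exists (e (l ++ m)); split.
  + by exists (l ++ m) => // a; rewrite mem_cat => /orP[/lI|/mI].
  + by apply: le_trans pl _; rewrite e_cat leUl.
  + by apply: le_trans qm _; rewrite e_cat leUr.
Qed.

(** * From chains of ideals to separating elements *)

(** What is kept of the chain of ideals: [J] stands for the ideal of the segment [< a]. *)
Definition ideal_separated (dA dP : Order.disp_t) (A : orderType dA)
    (P : joinSemilatticeType dP) (x0 : P) (x : A -> P) : Prop :=
  forall a, exists2 J, ideals P J &
    [/\ J x0, forall b, b < a -> J (x b) & ~ J (x a)].

Lemma ideal_separatedP (dA dP : Order.disp_t) (A : orderType dA)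
    (P : joinSemilatticeType dP) :
  contains_copy (ideals P) (initial_segments A) ->
  exists x0, exists x : A -> P, ideal_separated x0 x.
Proof.
move=> [E EJ [f [_ f_le]]].
have init0 : initial_segments A set0 by [].
have initle a : initial_segments A [set b | b <= a].
  by move=> x y xy /= ya; apply: le_trans ya.
have initlt a : initial_segments A [set b | b < a].
  by move=> x y xy /= ya; apply: le_lt_trans ya.
pose F I (HI : initial_segments A I) : set P := val (f (SigSub (mem_set HI))).
have F_le I J HI HJ : (@F I HI `<=` @F J HJ) <-> I `<=` J.
  by rewrite !(rwP (subsetPset _ _)) /F f_le.
have F_ideal I HI : ideals P (@F I HI) by apply/EJ/set_mem/valP.
have [[x0 Fx0] _ _] := F_ideal _ init0.
have /choice[x xP] a : exists p, F _ (initle a) p /\ ~ F _ (initlt a) p.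
  apply: contrapT => Fa.
  have /F_le : F _ (initle a) `<=` F _ (initlt a).
    by move=> p Fp; apply: contrapT => nFp; apply: Fa; exists p.
  by move=> /(_ a (lexx a)) /=; rewrite ltxx.
exists x0, x => a; exists (F _ (initlt a)) => //; split.
- by apply: (F_le _ _ init0 _).2 Fx0.
- move=> b ba; apply: (F_le _ _ (initle b) _).2 (xP b).1 => c /= cb.
  exact: le_lt_trans cb ba.
- exact: (xP a).2.
Qed.

(** * Joins of words over a family of elements *)

Section WordJoin.
Variables (d : Order.disp_t) (P : joinSemilatticeType d) (A : eqType).
Variables (x0 : P) (x : A -> P).

(** The base value [x0] gives the empty word a join, as [P] may lack a least element. *)
Definition word_join (l : seq A) : P := foldr (fun a p => x a `|` p) x0 l.

Lemma word_join_le l p :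
  word_join l <= p <-> x0 <= p /\ forall a, a \in l -> x a <= p.
Proof.
elim: l => [|a l IH] /=; first by split=> [|[]].
rewrite leUx; split=> [/andP[ap /IH[x0p lp]]|[x0p lp]].
  by split=> // b; rewrite inE => /orP[/eqP->|/lp].
apply/andP; split; first by apply: lp; rewrite mem_head.
by apply/IH; split=> // b bl; apply: lp; rewrite inE bl orbT.
Qed.

Lemma word_join_ge l a : a \in l -> x a <= word_join l.
Proof. by have [_] := (word_join_le l _).1 (lexx _); apply. Qed.

Lemma word_join_ge0 l : x0 <= word_join l.
Proof. by have [] := (word_join_le l _).1 (lexx _). Qed.

Lemma word_join_cat l m : word_join (l ++ m) = word_join l `|` word_join m.
Proof.
apply/le_anti/andP; split.
  apply/word_join_le; split=> [|a].
    by apply: le_trans (word_join_ge0 l) _; rewrite leUl.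
  rewrite mem_cat => /orP[] /word_join_ge h; apply: le_trans h _.
    by rewrite leUl.
  by rewrite leUr.
rewrite leUx; apply/andP; split; apply/word_join_le; split=> [|a al];
  by [apply: word_join_ge0|apply: word_join_ge; rewrite mem_cat al ?orbT].
Qed.

Lemma word_join_ideal (J : set P) l :
  ideals P J -> J x0 -> (forall a, a \in l -> J (x a)) -> J (word_join l).
Proof.
move=> [_ Jinit Jdir] J0; elim: l => [//|a l IH] Jl /=.
have [||q [Jq aq lq]] := Jdir (x a) (word_join l).
- by apply: Jl; rewrite mem_head.
- by apply: IH => b bl; apply: Jl; rewrite inE bl orbT.
by apply: Jinit Jq; rewrite leUx aq.
Qed.

Let R l m : Prop := word_join l <= word_join m.

Let R_trans l m n : R l m -> R m n -> R l n.
Proof. exact: le_trans. Qed.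

Let R_cat l m n : R (l ++ m) n <-> R l n /\ R m n.
Proof. by rewrite /R word_join_cat leUx; split=> [/andP|[-> ->]]. Qed.

Definition word_join_preorder : join_preorder A :=
  JoinPreorder (fun l => lexx (word_join l)) R_trans R_cat.

Lemma word_join_represents : jp_represents word_join_preorder word_join.
Proof. by split=> [|//]; apply: word_join_cat. Qed.

End WordJoin.

Section IdealSeparated.
Variables (dA dP : Order.disp_t) (A : orderType dA) (P : joinSemilatticeType dP).
Variables (x0 : P) (x : A -> P).
Hypothesis xsep : ideal_separated x0 x.

(** The ideal [J] attached to [a] contains the join of the word but not [x a]. *)
Lemma word_join_separated a l : (forall b, b \in l -> b < a) ->
  ~ x a <= word_join x0 x l.
Proof.
move=> la xal; have [J Jid [J0 Jlt Ja]] := xsep a; apply: Ja.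
have [_ Jinit _] := Jid; apply: Jinit xal _.
by apply: word_join_ideal => // b /la/Jlt.
Qed.

Lemma word_join_preorder_separated :
  @jp_separated dA A (word_join_preorder x0 x).
Proof.
move=> a l la h; apply: (word_join_separated la); apply: le_trans h.
by apply: word_join_ge; rewrite mem_head.
Qed.

(** As [A] is finite, [x a] can be replaced by the join of [x0] and all [x b] with [b <= a]; the
    same ideals still separate. *)
Lemma ideal_separated_mono : finite_set [set: A] ->
  exists2 y : A -> P, ideal_separated x0 y & {homo y : a b / a <= b}.
Proof.
move=> /finite_seqP[s sA].
have s_mem a : a \in s by have : [set: A] a by []; rewrite sA.
pose y a := word_join x0 x [seq b <- s | b <= a]; exists y => [a|a b ab].
  have [J Jid [J0 Jlt Ja]] := xsep a; exists J => //; split=> // [b ba|Jy].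
    apply: word_join_ideal => // c; rewrite mem_filter => /andP[cb _].
    exact/Jlt/(le_lt_trans cb).
  apply: Ja; have [_ Jinit _] := Jid; apply: Jinit Jy.
  by apply: word_join_ge; rewrite mem_filter lexx s_mem.
apply/word_join_le; split=> [|c]; first exact: word_join_ge0.
rewrite mem_filter => /andP[ca _]; apply: word_join_ge.
by rewrite mem_filter s_mem (le_trans ca ab).
Qed.

End IdealSeparated.

(** * The preorder for finite chains, and the count *)

Section ChainPreorder.
Variables (dA : Order.disp_t) (A : orderType dA).

(** Words are compared by the initial segments they generate; the quotient is the chain [A] with a
    new least element. *)
Let R (l m : seq A) : Prop :=
  forall a, a \in l -> exists2 b, b \in m & a <= b.

Let R_refl l : R l l.
Proof. by move=> a al; exists a. Qed.

Let R_trans l m n : R l m -> R m n -> R l n.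
Proof.
move=> lm mn a /lm[b /mn[c cn bc] ab]; exists c => //; exact: le_trans bc.
Qed.

Let R_cat l m n : R (l ++ m) n <-> R l n /\ R m n.
Proof.
split=> [lmn|[ln mn] a]; last by rewrite mem_cat => /orP[/ln|/mn].
by split=> a al; apply: lmn; rewrite mem_cat al ?orbT.
Qed.

Definition chain_preorder : join_preorder A := JoinPreorder R_refl R_trans R_cat.

Lemma chain_preorder_separated : jp_separated chain_preorder.
Proof.
move=> a l la /(_ a (mem_head _ _))[b /la ba].
by rewrite leNgt ba.
Qed.

Lemma chain_preorder_represents (dP : Order.disp_t) (P : joinSemilatticeType dP)
    (x0 : P) (x : A -> P) :
  ideal_separated x0 x -> {homo x : a b / a <= b} ->
  jp_represents chain_preorder (word_join x0 x).
Proof.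
move=> xsep xmono; split=> [|l m]; first exact: word_join_cat.
split=> [lm|lm a al].
  apply/word_join_le; split=> [|a /lm[b bm ab]]; first exact: word_join_ge0.
  exact: le_trans (xmono _ _ ab) (word_join_ge _ _ bm).
(* If no letter of [m] is above [a], all are [< a] by totality, against separation. *)
apply: contrapT => nm; apply: (word_join_separated xsep (a := a) (l := m)).
  by move=> b bm; rewrite ltNge; apply/negP => ab; apply: nm; exists b.
exact: le_trans (word_join_ge _ _ al) lm.
Qed.

End ChainPreorder.

(* If [A] is infinite, the join-preorders on [seq A] are at most [2 ^ #|A|] many.
   If [A] is finite this count fails, but a single one then suffices, because the
   separating elements may be replaced by an increasing family. *)
Lemma small_separated_preorders (dA : Order.disp_t) (A : orderType dA) :
  exists2 C : set (join_preorder A), card_le_powerset C A &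
    (forall R, C R -> jp_separated R) /\
    forall (dP : Order.disp_t) (P : joinSemilatticeType dP),
      contains_copy (ideals P) (initial_segments A) ->
      exists2 R, C R & exists e : seq A -> P, jp_represents R e.
Proof.
have [Afin|Ainf] := pselect (finite_set [set: A]).
  exists [set chain_preorder A]; first by exists (fun=> set0) => x y -> ->.
  split=> [_ ->|dP P /ideal_separatedP[x0 [x xsep]]].
    exact: chain_preorder_separated.
  have [y ysep ymono] := ideal_separated_mono xsep Afin.
  exists (chain_preorder A) => //; exists (word_join x0 y).
  exact: chain_preorder_represents.
have [f f_inj] := infinite_seq_coding Ainf.
exists (@jp_separated _ A).
  (* The graph of [R], a set of pairs of words, is coded as a subset of [A]. *)
  exists (fun R : join_preorder A => f @` [set t | R t.1 t.2]) => R S _ _ RS.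
  apply: join_preorder_inj => l m.
  have sub (R1 R2 : join_preorder A) :
      f @` [set t | R1 t.1 t.2] = f @` [set t | R2 t.1 t.2] ->
      R1 l m -> R2 l m.
    move=> e R1lm; have : (f @` [set t | R1 t.1 t.2]) (f (l, m)).
      by exists (l, m).
    by rewrite e => -[[l' m'] /= R2lm /f_inj[<- <-]].
  by split; apply: sub.
split=> // dP P /ideal_separatedP[x0 [x xsep]].
exists (word_join_preorder x0 x); first exact: word_join_preorder_separated.
by exists (word_join x0 x); apply: word_join_represents.
Qed.

Theorem mainTheorem2 (dA dB : Order.disp_t) (A : orderType dA) :
  exists B : joinSemilatticeType dB -> Prop,
    card_le_powerset B A /\
    forall (dP : Order.disp_t) (P : joinSemilatticeType dP),
      contains_copy (ideals P) (initial_segments A) <->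
      exists Q : joinSemilatticeType dB, B Q /\
        exists2 S : set P, join_subsemilattice S &
          order_isomorphic S [set: Q]%classic.
Proof.
have [C [f f_inj] [Csep Ccover]] := small_separated_preorders A.
pose B (Q : joinSemilatticeType dB) :=
  exists2 R, C R & Q = jp_quotient dB R :> joinSemilatticeType dB.
exists B; split.
  (* Each member of [B] is recovered from a chosen preorder [c Q] in [C], so the bound on [C] passes
     to [B]; outside [B] the value is a dummy. *)
  have /choice[c cP] (Q : joinSemilatticeType dB) : exists R, B Q ->
      C R /\ Q = jp_quotient dB R :> joinSemilatticeType dB.
    have [[R CR QR]|nB] := pselect (B Q); first by exists R.
    by exists (chain_preorder A).
  exists (f \o c) => Q Q' /cP[CQ eQ] /cP[CQ' eQ'] /f_inj e.
  by rewrite eQ eQ' e.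
move=> dP P; split=> [/Ccover[R CR Re]|[Q [[R CR ->] SQ]]].
  exists (jp_quotient dB R); split; first by exists R.
  exact/contains_quotient.
have [e eR] := (contains_quotient dB P R).2 SQ.
exact: ideals_contain_initial_segments (Csep _ CR) eR.
Qed.
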